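(* Let $\mathbb{K}$ be a field and let $\Gamma\subset\mathbb{N}^{r}$ be a simplicial affine semigroup minimally generated by $\mathbf{a}_1,\dots,\mathbf{a}_{r+n}$ with set of extremal rays $\{\mathbf{a}_1,\dots,\mathbf{a}_r\}$. Let $A=\mathbb{K}[z_1,\dots,z_{r+n}]$ and let $I_\Gamma\subset A$ be the defining ideal of $\mathbb{K}[\Gamma]$. Assume that $A/I_\Gamma$ is Cohen-Macaulay. Let $G=\{f_1,\dots,f_s\}$ be a minimal Gröbner basis of $I_\Gamma$ with respect to a monomial ordering $>$ on $A$. Suppose that $A/\mathrm{in}_{>}(I_\Gamma)$ is Cohen-Macaulay and that there exists $z_j$, $1\le j\le r$, such that $z_j$ belongs to the support of $f_l$ and does not divide $\mathrm{LM}(f_l)$, for every $1\le l\le s$. Then $$\beta_i(A/I_\Gamma)=\beta_i(A/\mathrm{in}_{>}(I_\Gamma))\quad\text{for all } i\ge 1.$$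
   Context: An affine semigroup $\Gamma\subset\mathbb{N}^r$ is a finitely generated subsemigroup containing $0$. It is simplicial with extremal rays $\mathbf{a}_1,\dots,\mathbf{a}_r$ if $\mathbf{a}_1,\dots,\mathbf{a}_r$ are linearly independent over $\mathbb{Q}$, $\Gamma\subset\sum_{i=1}^r\mathbb{Q}_{\ge 0}\mathbf{a}_i$, and each $\mathbf{a}_i$ is the smallest non-zero element of $\Gamma$ on the ray it spans. The semigroup ring is $\mathbb{K}[\Gamma]=\bigoplus_{\gamma\in\Gamma}\mathbb{K}\mathfrak{t}^{\gamma}\subset\mathbb{K}[t_1,\dots,t_r]$, where $\mathfrak{t}^\gamma=\prod_{i=1}^r t_i^{\gamma_i}$. The defining ideal is $I_\Gamma=\ker\phi$, where $\phi:A\to\mathbb{K}[\Gamma]$ is the $\mathbb{K}$-algebra map with $\phi(z_i)=\mathfrak{t}^{\mathbf{a}_i}$ for $1\le i\le r+n$. $\mathrm{LM}(f)$ is the leading monomial of $f$ with respect to $>$, and $\mathrm{in}_{>}(I)$ is the ideal generated by the leading monomials of the non-zero elements of $I$. A variable $z_j$ belongs to the support of a polynomial $f$ if $z_j$ divides some monomial occurring in $f$ with non-zero coefficient. $\beta_i(A/J)$ denotes the $i$-th total Betti number of $A/J$ in its minimal free resolution over $A$ (graded by $\deg z_i=\mathbf{a}_i$).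
   Formalization: Each f_l is additionally assumed homogeneous for the grading deg z_i = a_i (as holds for binomials in I_Γ); for inhomogeneous minimal Gröbner bases the claim is false, e.g. for Γ=<5,6,9> with y^3-w^2+yw-x^3, yw-x^3, w^3-x^3y^2. *)

(* Defs.v *)
From HB Require Import structures.
From Stdlib Require Import ClassicalEpsilon.
From mathcomp Require Import all_boot all_order all_algebra.
From mathcomp Require Export mpoly.

Set Implicit Arguments.
Unset Strict Implicit.
Unset Printing Implicit Defensive.

Import GRing.Theory.
Local Open Scope ring_scope.

(* Ideals are Prop-valued predicates, since the ideals considered need not be
   decidable.  A quotient R/J is handled through R and J. *)
Section Ideals.
Variable R : comNzRingType.
Implicit Types (I J P S : R -> Prop).

Definition subpred_prop S1 S2 := forall x : R, S1 x -> S2 x.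

Definition is_ideal I :=
  [/\ I 0, forall x y, I x -> I y -> I (x + y) & forall r x, I x -> I (r * x)].

Definition is_prime_ideal P :=
  [/\ is_ideal P, ~ P 1 & forall x y, P (x * y) -> P x \/ P y].

Definition is_maximal_ideal P :=
  [/\ is_ideal P, ~ P 1 &
      forall I, is_ideal I -> subpred_prop P I -> ~ I 1 -> subpred_prop I P].

Definition ideal_gen S : R -> Prop := fun p =>
  exists s : seq (R * R),
    (forall x, x \in s -> S x.2) /\ p = \sum_(x <- s) x.1 * x.2.

(* s is a weak regular sequence on R/J.  It is only used for s contained in a
   proper ideal containing J, so (J, s) <> R holds automatically. *)
Fixpoint regular_seq J (s : seq R) : Prop :=
  if s is x :: s' then
    (forall y, J (x * y) -> J y) /\
    regular_seq (ideal_gen (fun z => J z \/ z = x)) s'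
  else True.

(* grade of the ideal P/J on the ring R/J *)
Definition depth_is J P (k : nat) :=
  (exists s, [/\ size s = k, forall x, x \in s -> P x & regular_seq J s]) /\
  (forall s, (forall x, x \in s -> P x) -> regular_seq J s -> (size s <= k)%N).

(* a chain c 0 < c 1 < ... < c k = P of prime ideals containing J *)
Definition prime_chain J P (k : nat) (c : nat -> R -> Prop) :=
  [/\ forall i, (i <= k)%N -> is_prime_ideal (c i) /\ subpred_prop J (c i),
      forall i, (i < k)%N ->
        subpred_prop (c i) (c i.+1) /\ ~ subpred_prop (c i.+1) (c i) &
      forall x, c k x <-> P x].

(* height of P/J in R/J, i.e. the Krull dimension of (R/J)_P *)
Definition height_is J P (k : nat) :=
  (exists c, prime_chain J P k c) /\
  (forall l c, prime_chain J P l c -> (l <= k)%N).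

(* The (Noetherian) ring R/J is Cohen-Macaulay: depth(P) = codim(P) for every
   maximal ideal P of R/J (Eisenbud, Commutative Algebra, Section 18.2). *)
Definition quotient_CM J :=
  forall P, is_maximal_ideal P -> subpred_prop J P ->
    exists k, depth_is J P k /\ height_is J P k.

End Ideals.

(* N^r is the additive monoid 'X_{1..r} of exponent vectors. *)
Section AffineSemigroups.
Variable r : nat.
Implicit Types (Gamma : 'X_{1..r} -> Prop) (g : 'X_{1..r}).

(* \sum_i u_i a_i; also the degree of the monomial z^u when deg z_i = a_i *)
Definition wdeg m (a : 'I_m -> 'X_{1..r}) (u : 'X_{1..m}) : 'X_{1..r} :=
  (\sum_(i < m) (a i *+ u i))%MM.

(* g is an N-linear combination of the a_i with i in D *)
Definition in_span m (a : 'I_m -> 'X_{1..r}) (D : pred 'I_m) g :=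
  exists u : 'X_{1..m}, (forall i, ~~ D i -> u i = 0%N) /\ g = wdeg a u.

Definition affine_semigroup Gamma :=
  [/\ Gamma 0%MM,
      forall g h, Gamma g -> Gamma h -> Gamma (g + h)%MM &
      exists m (a : 'I_m -> 'X_{1..r}),
        forall g, Gamma g <-> in_span a predT g].

Definition minimally_generated m Gamma (a : 'I_m -> 'X_{1..r}) :=
  (forall g, Gamma g <-> in_span a predT g) /\
  (forall i, ~ (forall g, Gamma g <-> in_span a (predC1 i) g)).

Definition simplicial Gamma (e : 'I_r -> 'X_{1..r}) :=
  [/\ row_free (\matrix_(i < r, k < r) ((e i k)%:R : rat)),
      forall g, Gamma g ->
        exists q : 'I_r -> rat, (forall i, 0 <= q i) /\
          forall k, (g k)%:R = \sum_(i < r) q i * (e i k)%:R,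
      forall i, Gamma (e i) /\ e i <> 0%MM &
      forall i g (q : rat), Gamma g -> g <> 0%MM -> 0 <= q ->
        (forall k, (g k)%:R = q * (e i k)%:R) -> (e i <= g)%MM].

End AffineSemigroups.

(* kernel of K[z_1..z_m] -> K[t_1..t_r], z_i |-> t^{a_i} *)
Definition toric_ideal (K : fieldType) r m (a : 'I_m -> 'X_{1..r})
    (p : {mpoly K[m]}) : Prop :=
  mmap (@mpolyC r K) (fun i => 'X_[K, a i]) p = 0.

Section Groebner.
Variables (K : fieldType) (m : nat).
Variable le : rel 'X_{1..m}.
Implicit Types (f p : {mpoly K[m]}) (I : {mpoly K[m]} -> Prop).

Definition monomial_order :=
  [/\ total le, antisymmetric le, transitive le,
      forall u v w : 'X_{1..m}, le u v -> le (u + w)%MM (v + w)%MM &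
      forall u : 'X_{1..m}, le 0%MM u].

(* exponent of the leading monomial (0 when f = 0) *)
Definition LM f : 'X_{1..m} :=
  \big[(fun u v => if le u v then v else u)/0%MM]_(u <- msupp f) u.

Definition initial_ideal I : {mpoly K[m]} -> Prop :=
  ideal_gen (fun p => exists f, [/\ I f, f <> 0 & p = 'X_[LM f]]).

(* The f_l need not be monic, which covers both conventions for minimality. *)
Definition minimal_groebner_basis I s (f : 'I_s -> {mpoly K[m]}) :=
  [/\ forall l, I (f l) /\ f l <> 0,
      forall p, initial_ideal I p <->
        ideal_gen (fun q => exists l, q = 'X_[LM (f l)]) p &
      forall l l', l != l' -> ~~ (LM (f l) <= LM (f l'))%MM].

End Groebner.

Definition in_support (K : fieldType) m (i : 'I_m) (f : {mpoly K[m]}) :=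
  exists u : 'X_{1..m}, u \in msupp f /\ (U_(i) <= u)%MM.

(* f is homogeneous of degree g for the grading deg z_i = a_i.  Every binomial
   of the toric ideal is homogeneous.  Inhomogeneous minimal Groebner bases have
   to be excluded in the theorem: for the semigroup <5,6,9> and an order of
   weights (0, 2, 2.1) on (x, y, w), take y^3 - w^2 + y w - x^3, y w - x^3 and
   w^3 - x^3 y^2, with leading monomials y^3, y w, w^3.  All other hypotheses
   hold with z_j = x, but the first Betti numbers are 2 and 3. *)
Definition homog_of (K : fieldType) r m (a : 'I_m -> 'X_{1..r})
    (g : 'X_{1..r}) (f : {mpoly K[m]}) :=
  forall u, u \in msupp f -> wdeg a u = g.

Section Betti.
Variables (K : fieldType) (r m : nat).
Variable a : 'I_m -> 'X_{1..r}.
Local Notation A := {mpoly K[m]}.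

(* ... -> F_2 -> F_1 -> F_0 -> A, with F_i = A^(rk i) (row vectors) having its
   k-th basis vector in degree shift i k, and the maps acting by v |-> v *m M.
   Shifts in N^r suffice: in a minimal graded resolution of a quotient of A
   they are degrees of monomials. *)
Record free_complex := FreeComplex {
  rk : nat -> nat;
  shift : forall i, 'I_(rk i) -> 'X_{1..r};
  diff : forall i, 'M[A]_(rk i.+1, rk i);
  aug : 'cV[A]_(rk 0)
}.

Definition graded_complex (F : free_complex) :=
  (forall k u, u \in msupp (aug F k 0) -> wdeg a u = shift k) /\
  (forall i k l u, u \in msupp (diff F i k l) ->
     (shift l + wdeg a u)%MM = shift k).

(* exactness of ... -> F_1 -> F_0 -> A/J -> 0 *)
Definition resolves (J : A -> Prop) (F : free_complex) :=
  [/\ forall p : A, exists v : 'rV_(rk F 0), J (p - (v *m aug F) 0 0),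
      forall v : 'rV_(rk F 0),
        J ((v *m aug F) 0 0) <-> exists w, v = w *m diff F 0 &
      forall i (v : 'rV_(rk F i.+1)),
        v *m diff F i = 0 <-> exists w, v = w *m diff F i.+1].

(* the image of F_(i+1) lies in (z_1, ..., z_m) F_i *)
Definition minimal_complex (F : free_complex) :=
  forall i k l, (diff F i k l)@_0%MM = 0.

Definition minimal_graded_free_resolution (J : A -> Prop) (F : free_complex) :=
  [/\ graded_complex F, resolves J F & minimal_complex F].

Definition betti (J : A -> Prop) (i : nat) : nat :=
  epsilon (inhabits 0%N)
    (fun b => exists F, minimal_graded_free_resolution J F /\ rk F i = b).

End Betti.

(* Main.v *)
(* Put z = z_j and J = in_>(I_Gamma).  Each f_l is homogeneous, so LM(f_l) has
   the same degree as a monomial divisible by z that occurs in f_l; hence J is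
   contained in I_Gamma + (z).  Conversely, the smallest monomial divisible by z
   in a given degree is standard: otherwise replace in it a factor LM(f_l), which
   does not involve z, by that monomial of f_l.  As each degree contains at most
   one standard monomial, I_Gamma is contained in J + (z).  Since z is a
   nonzerodivisor modulo both ideals, adding suitable multiples of z to the
   differentials, one after the other, turns a minimal graded free resolution of
   one quotient into one of the other with the same ranks and shifts; exactness
   follows by graded Nakayama. *)
Require Import Defs.
From Stdlib Require Import ClassicalEpsilon FunctionalExtensionality.
From Stdlib Require Import PropExtensionality.
From mathcomp Require Import all_boot all_order all_algebra.

Set Implicit Arguments.
Unset Strict Implicit.
Unset Printing Implicit Defensive.

Import GRing.Theory.
Local Open Scope ring_scope.

(** * Ideals generated by a set *)

Lemma is_ideal_gen (R : comNzRingType) (S : R -> Prop) : is_ideal (ideal_gen S).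
Proof.
split=> [|x y [t [St ->]] [t' [St' ->]]|c x [t [St ->]]].
- by exists [::]; rewrite big_nil.
- exists (t ++ t'); rewrite big_cat; split=> // w.
  by rewrite mem_cat => /orP[/St|/St'].
exists [seq (c * w.1, w.2) | w <- t]; split=> [w /mapP[w' /St Sw ->] //|].
by rewrite big_map mulr_sumr; apply: eq_bigr => w _; rewrite mulrA.
Qed.

Lemma ideal_gen_least (R : comNzRingType) (S L : R -> Prop) x :
  is_ideal L -> (forall y, S y -> L y) -> ideal_gen S x -> L x.
Proof.
move=> [L0 LD LM] SL [t [St ->]]; rewrite big_seq.
by apply: big_ind => // w /St/SL; apply: LM.
Qed.

Lemma ideal_gen_mem (R : comNzRingType) (S : R -> Prop) x :
  S x -> ideal_gen S x.
Proof.
move=> Sx; exists [:: (1, x)]; rewrite big_seq1 mul1r; split=> // w.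
by rewrite inE => /eqP ->.
Qed.

(** * Restriction of a polynomial to a set of monomials *)

Section MonomialFilter.
Variables (K : fieldType) (m : nat).
Implicit Types (P Q : pred 'X_{1..m}) (p q : {mpoly K[m]}).

(** Graded components, degree truncations and the terms not divisible by a variable all arise from
    this one projection, by varying the predicate. *)
Definition mfilter P p : {mpoly K[m]} :=
  \sum_(u <- msupp p | P u) p@_u *: 'X_[u].

Lemma mcoeff_mfilter P p u : (mfilter P p)@_u = if P u then p@_u else 0.
Proof.
rewrite /mfilter linear_sum /=.
under eq_bigr do rewrite mcoeffZ mcoeffX.
have [up|up] := boolP (u \in msupp p); last first.
  rewrite (memN_msupp_eq0 up) if_same big_seq_cond big1 // => v /andP[vp _].
  by case: eqP => [vu|_]; rewrite ?mulr0 // -vu vp in up *.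
rewrite big_mkcond (bigD1_seq u) ?msupp_uniq //= eqxx mulr1.
by rewrite big1 ?addr0 // => v /negbTE ->; rewrite mulr0 if_same.
Qed.

Lemma eq_mfilter P Q p : P =1 Q -> mfilter P p = mfilter Q p.
Proof. by move=> PQ; apply/mpolyP => u; rewrite !mcoeff_mfilter PQ. Qed.

Lemma mfilterD P p q : mfilter P (p + q) = mfilter P p + mfilter P q.
Proof.
apply/mpolyP => u; rewrite mcoeffD !mcoeff_mfilter mcoeffD.
by case: ifP => // _; rewrite addr0.
Qed.

Lemma mfilter0 P : mfilter P 0 = 0.
Proof. by apply/mpolyP => u; rewrite mcoeff_mfilter mcoeff0 if_same. Qed.

Lemma mfilter_sum P (I : Type) (s : seq I) (F : I -> {mpoly K[m]}) :
  mfilter P (\sum_(i <- s) F i) = \sum_(i <- s) mfilter P (F i).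
Proof. exact: (big_morph _ (mfilterD P) (mfilter0 P)). Qed.

Lemma mfilter_term P (c : K) u :
  mfilter P (c *: 'X_[u]) = if P u then c *: 'X_[u] else 0.
Proof.
apply/mpolyP => v; rewrite mcoeff_mfilter mcoeffZ mcoeffX.
case: ifP => Pv; case: ifP => Pu; rewrite ?mcoeffZ ?mcoeffX ?mcoeff0 //.
  by case: eqP => [uv|]; rewrite ?mulr0 // -uv Pu in Pv *.
by case: eqP => [uv|]; rewrite ?mulr0 // -uv Pu in Pv *.
Qed.

(** Every monomial of [p * q] is a product of a monomial of [p] and one of [q]. The typical case is
    a homogeneous [q], with [P] a condition on degrees and [Q] its shift by the degree of [q]. *)
Lemma mfilterM P Q p q :
    (forall u v, v \in msupp q -> P (u + v)%MM = Q u) ->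
  mfilter P (p * q) = mfilter Q p * q.
Proof.
move=> PQ; apply/mpolyP => u; rewrite mcoeff_mfilter !mcoeffM.
case: ifP => Pu; last symmetry.
  apply: eq_bigr => k /eqP uE; rewrite mcoeff_mfilter.
  have [/PQ PQk|/memN_msupp_eq0 ->] := boolP (bmnm k.2 \in msupp q).
    by rewrite -PQk -uE Pu.
  by rewrite !mulr0.
apply: big1 => k /eqP uE; rewrite mcoeff_mfilter.
have [/PQ PQk|/memN_msupp_eq0 ->] := boolP (bmnm k.2 \in msupp q).
  by rewrite -PQk -uE Pu mul0r.
by rewrite mulr0.
Qed.

End MonomialFilter.

(** * Graded submodules of free modules, compared modulo a variable *)

Section Lifting.
Variables (K : fieldType) (r m : nat) (a : 'I_m -> 'X_{1..r}) (j : 'I_m).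
Hypothesis aj_gt0 : (0 < mdeg (a j))%N.
Local Notation A := {mpoly K[m]}.
Local Notation z := ('X_j : A).
Implicit Types (k : nat) (P : pred 'X_{1..r}).

Lemma wdegD u v : wdeg a (u + v)%MM = (wdeg a u + wdeg a v)%MM.
Proof.
rewrite /wdeg -big_split /=; apply: eq_bigr => i _.
by apply/mnmP => l; rewrite !(mnmDE, mulmnE) mulnDr.
Qed.

Lemma wdegU i : wdeg a U_(i) = a i.
Proof.
rewrite /wdeg (bigD1 i) //= big1 => [|l /negbTE li].
  by rewrite addm0 mnm1E eqxx.
by rewrite mnm1E eq_sym li.
Qed.

Section OneModule.
Variables (k : nat) (sh : 'I_k -> 'X_{1..r}).
Implicit Types (v w : 'rV[A]_k) (M N T : 'rV[A]_k -> Prop).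

(** The basis vector of index [l] has degree [sh l], so [P] is tested on the degree of each term of
    [v]. *)
Definition vfilter P v : 'rV[A]_k :=
  \row_l mfilter (fun u => P (sh l + wdeg a u)%MM) (v 0 l).

Definition submodule N := N 0 /\ forall c v w, N v -> N w -> N (c *: v + w).
Definition graded N := forall P v, N v -> N (vfilter P v).
Definition saturated N := forall v, N (z *: v) -> N v.
(** For a submodule [N] this means that [M] lies in the sum of [N] and [z] times the free module. *)
Definition incl_mod M N := forall v, M v -> exists w, N (v + z *: w).

Lemma vfilterD P v w : vfilter P (v + w) = vfilter P v + vfilter P w.
Proof. by apply/rowP => l; rewrite !mxE mfilterD. Qed.

Lemma vfilterB P v w : vfilter P (v - w) = vfilter P v - vfilter P w.
Proof. by apply: (addIr (vfilter P w)); rewrite -vfilterD !subrK. Qed.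

Lemma vfilterZ P v :
  vfilter P (z *: v) = z *: vfilter (fun d => P (d + a j)%MM) v.
Proof.
apply/rowP => l; rewrite !mxE mulrC [RHS]mulrC; apply: mfilterM => u w.
by rewrite msuppX inE => /eqP ->; rewrite wdegD wdegU addmA.
Qed.

Lemma vfilter_pred0 v : vfilter pred0 v = 0.
Proof.
apply/rowP => l; apply/mpolyP => u.
by rewrite !mxE mcoeff_mfilter mcoeff0.
Qed.

Lemma vfilter_id P v :
  (forall l u, u \in msupp (v 0 l) -> P (sh l + wdeg a u)%MM) -> vfilter P v = v.
Proof.
move=> Pv; apply/rowP => l; apply/mpolyP => u; rewrite mxE mcoeff_mfilter.
have [/Pv -> //|/memN_msupp_eq0 ->] := boolP (u \in msupp (v 0 l)).
by rewrite if_same.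
Qed.

Lemma vfilter_supp P v l u :
  u \in msupp (vfilter P v 0 l) -> P (sh l + wdeg a u)%MM.
Proof.
by rewrite mcoeff_msupp mxE mcoeff_mfilter; case: ifP => // _; rewrite eqxx.
Qed.

Lemma submoduleD N v w : submodule N -> N v -> N w -> N (v + w).
Proof. by case=> _ NZ Nv Nw; rewrite -[v]scale1r; apply: NZ. Qed.

Lemma submoduleZ N c v : submodule N -> N v -> N (c *: v).
Proof. by case=> N0 NZ Nv; rewrite -[_ *: _]addr0; apply: NZ. Qed.

Lemma submoduleB N v w : submodule N -> N v -> N w -> N (v - w).
Proof.
move=> sN Nv Nw; apply: submoduleD => //.
by rewrite -scaleN1r; apply: submoduleZ.
Qed.

(** Induction on a strict bound [b] for the total degrees of the terms of [v]. Since [z] has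
    positive degree, truncating [v = t + z *: w] below [b.+1] truncates [w] below [b], and the
    truncated [w] is in [T] by induction. *)
Lemma graded_nakayama N T :
    graded N -> submodule T -> graded T ->
    (forall v, N v -> exists t w, [/\ T t, N w & v = t + z *: w]) ->
  forall v, N v -> T v.
Proof.
move=> grN sT grT NT v.
have [b vb]: exists b, vfilter (fun d => mdeg d < b)%N v = v.
  exists (\max_(l < k) \max_(u <- msupp (v 0%R l)) mdeg (sh l + wdeg a u)%MM).+1.
  apply: vfilter_id => l u ul; rewrite ltnS.
  apply: (bigmax_sup l) => //.
  by apply: (bigmax_sup_seq u).
elim: b v vb => [|b IH] v vb Nv.
  suff <-: 0 = v by case: sT.
  by rewrite -vb -[LHS](vfilter_pred0 v).
have [t [w [Tt Nw vE]]] := NT _ Nv.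
rewrite -vb vE vfilterD vfilterZ; apply: submoduleD => //; first exact: grT.
apply: submoduleZ => //; apply: IH; last exact: grN.
apply: vfilter_id => l u /vfilter_supp; rewrite mdegD ltnS.
by apply: leq_trans; rewrite -addn1 leq_add2l.
Qed.

End OneModule.

Definition hom_mx k1 k2 (sh1 : 'I_k1 -> 'X_{1..r}) (sh2 : 'I_k2 -> 'X_{1..r})
    (D : 'M[A]_(k2, k1)) :=
  forall i l u, u \in msupp (D i l) -> (sh1 l + wdeg a u)%MM = sh2 i.

Lemma vfilter_mulmx k1 k2 (sh1 : 'I_k1 -> 'X_{1..r}) (sh2 : 'I_k2 -> 'X_{1..r})
    (D : 'M[A]_(k2, k1)) P w :
    hom_mx sh1 sh2 D ->
  vfilter sh1 P (w *m D) = vfilter sh2 P w *m D.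
Proof.
move=> grD; apply/rowP => l; rewrite !mxE mfilter_sum; apply: eq_bigr => i _.
rewrite mxE; apply: mfilterM => u v /grD <-.
by rewrite wdegD; congr P; apply/mnmP=> h; rewrite !mnmDE addnCA addnC.
Qed.

Lemma row_mulmx_sum k1 k2 (D : 'M[A]_(k2, k1)) (w : 'rV_k2) N :
  submodule N -> (forall i, N (row i D)) -> N (w *m D).
Proof.
move=> sN ND; rewrite mulmx_sum_row.
apply: big_ind => [|v v' Nv Nv'|i _]; first by case: sN.
  exact: submoduleD.
exact: submoduleZ.
Qed.

Definition saturated_submodule k (sh : 'I_k -> 'X_{1..r}) N :=
  [/\ submodule N, graded sh N & saturated N].

Definition spans k1 k2 (D : 'M[A]_(k2, k1)) (N : 'rV[A]_k1 -> Prop) :=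
  forall v, N v <-> exists w, v = w *m D.

Lemma spans_row k1 k2 (D : 'M[A]_(k2, k1)) N i : spans D N -> N (row i D).
Proof. by move=> DN; apply/DN; exists (delta_mx 0 i); rewrite rowE. Qed.

(** Each row of [D] is moved into [N] by a multiple of [z], and its component of the right degree is
    kept. The new rows generate [N] by graded Nakayama: an element of [N] is a combination of them
    modulo [z], and saturation puts the cofactor of [z] in [N]. *)
Lemma lift_generators k1 k2 (sh1 : 'I_k1 -> 'X_{1..r})
    (sh2 : 'I_k2 -> 'X_{1..r}) (D : 'M[A]_(k2, k1)) M N :
    hom_mx sh1 sh2 D -> saturated_submodule sh1 N -> spans D M ->
    incl_mod M N -> incl_mod N M ->
  exists D', [/\ hom_mx sh1 sh2 D', exists E, D' = D + z *: E & spans D' N].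
Proof.
move=> homD [sN grN satN] DM MN NM.
have [w wP] : exists w : 'I_k2 -> 'rV[A]_k1, forall i, N (row i D + z *: w i).
  exists (fun i => proj1_sig
    (constructive_indefinite_description _ (MN _ (spans_row i DM)))).
  by move=> i; case: constructive_indefinite_description.
pose dr i := row i D + z *: w i.
pose D' := \matrix_i vfilter sh1 (pred1 (sh2 i)) (dr i).
have homD' : hom_mx sh1 sh2 D'.
  move=> i l u.
  have -> : D' i l = vfilter sh1 (pred1 (sh2 i)) (dr i) 0 l by rewrite !mxE.
  by move/vfilter_supp/eqP.
(* Multiplication by [z] raises degrees by [a j], whence the shifted predicate. *)
pose E := \matrix_i vfilter sh1 (fun d => pred1 (sh2 i) (d + a j)%MM) (w i).
have D'E : D' = D + z *: E.
  apply/row_matrixP => i; rewrite linearD linearZ /= !rowK vfilterD vfilterZ.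
  congr (_ + _); apply: vfilter_id => l u; rewrite mxE => /homD ->.
  exact: eqxx.
have ND' v : N (v *m D').
  by apply: row_mulmx_sum => // i; rewrite rowK; apply: grN; apply: wP.
exists D'; split; [by []|by exists E|move=> v; split=> [|[x ->] //]].
move: v; apply: (@graded_nakayama _ sh1 N (fun v => exists w, v = w *m D')) => //.
- split=> [|c _ _ [x ->] [y ->]]; first by exists 0; rewrite mul0mx.
  by exists (c *: x + y); rewrite mulmxDl scalemxAl.
- by move=> P _ [x ->]; exists (vfilter sh2 P x); apply: vfilter_mulmx.
move=> v Nv; have [y /DM[x vyx]] := NM _ Nv.
(* Substitute [D = D' - z *: E] in [v + z *: y = x *m D]. *)
have vE : v = x *m D' + z *: - (x *m E + y).
  rewrite D'E mulmxDr -scalemxAr -vyx scalerN scalerDr opprD.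
  by rewrite addrA !addrK.
exists (x *m D'), (- (x *m E + y)); split=> //; first by exists x.
apply: satN; rewrite -[_ *: _](addKr (x *m D')) -vE addrC.
exact: submoduleB.
Qed.

(* If v D = 0 then v (D + z E) = z (v E), so v E lies in N = im (D + z E) by
   saturation, and v can be corrected by a multiple of z. *)
Lemma ker_incl_mod k1 k2 (D E : 'M[A]_(k2, k1)) N :
    saturated N -> spans (D + z *: E) N ->
  incl_mod (fun v => v *m D = 0) (fun v => v *m (D + z *: E) = 0).
Proof.
move=> satN DEN v vD.
have [x vE] : exists x, v *m E = x *m (D + z *: E).
  apply/DEN/satN/DEN; exists v.
  by rewrite mulmxDr vD add0r scalemxAr.
exists (- x); rewrite mulmxDl mulmxDr vD add0r -scalemxAr vE.
by rewrite -scalemxAl mulNmx scalerN addrN.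
Qed.

(** A homogeneous matrix commutes with truncation, and [z] is a nonzerodivisor on a free module. *)
Lemma ker_saturated_submodule k1 k2 (sh1 : 'I_k1 -> 'X_{1..r})
    (sh2 : 'I_k2 -> 'X_{1..r}) (D : 'M[A]_(k2, k1)) :
  hom_mx sh1 sh2 D -> saturated_submodule sh2 (fun v => v *m D = 0).
Proof.
move=> homD; split.
- split=> [|c v w vD wD]; first by rewrite mul0mx.
  by rewrite mulmxDl -scalemxAl vD wD scaler0 addr0.
- move=> P v vD; rewrite -(vfilter_mulmx P v homD) vD.
  apply/rowP => l; rewrite !mxE; exact: mfilter0.
- move=> v; rewrite -scalemxAl => /matrixP zvD; apply/matrixP => i l.
  move: (zvD i l); rewrite !mxE => /eqP; rewrite mulf_eq0.
  by rewrite -msupp_eq0 msuppX => /eqP.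
Qed.

(** * Lifting a minimal graded resolution from one ideal to another *)

Section Resolution.
Variables (I J : A -> Prop) (F : free_complex K r m).

Definition graded_ideal (J : A -> Prop) :=
  forall (P : pred 'X_{1..r}) p, J p -> J (mfilter (fun u => P (wdeg a u)) p).

(** Level 0 is the kernel of the map from [F_0] to [A/J], so that exactness at every level reads
    [spans (diff F i)]. *)
Definition syzygies (J : A -> Prop) i : 'rV[A]_(rk F i) -> Prop :=
  if i is i'.+1 return 'rV[A]_(rk F i) -> Prop
  then fun v => v *m diff F i' = 0 else fun v => J ((v *m aug F) 0 0).

(** Choosing by [epsilon] allows the whole complex to be defined before a suitable matrix is known
    to exist; [lifted_spec] supplies the existence. *)
Definition lift_diff i (N : 'rV[A]_(rk F i) -> Prop) :=
  epsilon (inhabits (0 : 'M[A]_(rk F i.+1, rk F i))) (fun D' =>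
    [/\ hom_mx (@shift _ _ _ F i) (@shift _ _ _ F i.+1) D',
        exists E, D' = diff F i + z *: E & spans D' N]).

Fixpoint lifted_syzygies i : 'rV[A]_(rk F i) -> Prop :=
  if i is i'.+1 return 'rV[A]_(rk F i) -> Prop
  then fun v => v *m lift_diff (@lifted_syzygies i') = 0
  else fun v => J ((v *m aug F) 0 0).

Definition lifted_complex :=
  FreeComplex (@shift _ _ _ F) (fun i => lift_diff (@lifted_syzygies i)) (aug F).

Definition ideal_incl_mod (I J : A -> Prop) :=
  forall p, I p -> exists w, J (p + z * w).

Hypotheses (idI : is_ideal I) (idJ : is_ideal J).
Hypotheses (grI : graded_ideal I) (grJ : graded_ideal J).
Hypotheses (satI : forall p, I (z * p) -> I p) (satJ : forall p, J (z * p) -> J p).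
Hypotheses (IJ : ideal_incl_mod I J) (JI : ideal_incl_mod J I).
Hypothesis F_res : minimal_graded_free_resolution a I F.

Lemma hom_aug : hom_mx (fun _ => 0%MM) (@shift _ _ _ F 0) (aug F).
Proof. by case: F_res => [[augF _] _ _] k l u; rewrite ord1 add0m; apply: augF. Qed.

Lemma vfilter_aug P (v : 'rV_(rk F 0)) :
  (vfilter (@shift _ _ _ F 0) P v *m aug F) 0 0
    = mfilter (fun u => P (wdeg a u)) ((v *m aug F) 0 0).
Proof.
rewrite -(vfilter_mulmx P v hom_aug) mxE.
by apply: eq_mfilter => u; rewrite add0m.
Qed.

Lemma saturated_syzygies0 L : is_ideal L -> graded_ideal L ->
    (forall p, L (z * p) -> L p) ->
  saturated_submodule (@shift _ _ _ F 0) (fun v => L ((v *m aug F) 0 0)).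
Proof.
move=> [L0 LD LM] grL satL; split.
- split=> [|c v w Lv Lw]; first by rewrite mul0mx mxE.
  by rewrite mulmxDl -scalemxAl mxE [X in X + _]mxE; apply: LD => //; apply: LM.
- by move=> P v Lv; rewrite vfilter_aug; apply: grL.
- by move=> v; rewrite -scalemxAl mxE => /satL.
Qed.

(** Surjectivity modulo [I] gives surjectivity modulo [J + (z)], and Nakayama removes [z]. *)
Lemma aug_surj (p : A) : exists v : 'rV_(rk F 0), J (p - (v *m aug F) 0 0).
Proof.
have [J0 JD JM] := idJ.
pose T := fun x : 'rV[A]_1 => exists v : 'rV_(rk F 0), J ((x - v *m aug F) 0 0).
suff [v Jv] : T p%:M.
  by exists v; move: Jv; rewrite !mxE eqxx mulr1n.
(* The ring is viewed as a free module of rank one generated in degree 0. *)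
apply: (@graded_nakayama 1 (fun _ => 0%MM) (fun=> True) T) => //.
- split=> [|c q1 q2 [x Jx] [y Jy]]; first by exists 0; rewrite mul0mx subr0 mxE.
  exists (c *: x + y).
  have -> : (c *: q1 + q2) - (c *: x + y) *m aug F
            = c *: (q1 - x *m aug F) + (q2 - y *m aug F).
    by rewrite mulmxDl -scalemxAl scalerBr addrACA opprD.
  by rewrite mxE [X in X + _]mxE; apply: JD => //; apply: JM.
- move=> P x [v Jv]; exists (vfilter (@shift _ _ _ F 0) P v).
  rewrite -(vfilter_mulmx P v hom_aug) -vfilterB mxE
    (eq_mfilter _ (Q := fun u => P (wdeg a u))) => [|u]; first exact: grJ.
  by rewrite add0m.
move=> x _; have [_ [surj _ _] _] := F_res; have [v /IJ[w Jw]] := surj (x 0 0).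
exists (x + z *: w%:M), (- w%:M); split=> //; last by rewrite scalerN addrK.
exists v; move: Jw; rewrite !mxE eqxx mulr1n; congr J; exact: addrAC.
Qed.

Lemma ideal_subst L (p q w : A) :
  is_ideal L -> L (p + z * w) -> L (w - q) -> L (p + z * q).
Proof.
move=> [_ LD LM] Lp Lq.
have -> : p + z * q = (p + z * w) + (- z) * (w - q).
  by rewrite mulNr mulrBr opprB [p + z * w]addrC [RHS]addrC addrA subrK addrC.
by apply: LD => //; apply: LM.
Qed.

(** The correcting polynomial [w] has to come from [F_0]; surjectivity of the augmentation modulo
    [J] replaces it by an image. *)
Lemma syzygies0_incl_mod :
  incl_mod (fun v => I ((v *m aug F) 0 0)) (fun v => J ((v *m aug F) 0 0)).
Proof.
move=> v /IJ[w Jw]; have [x Jx] := aug_surj w.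
exists x; rewrite mulmxDl -scalemxAl mxE [X in _ + X]mxE.
exact: ideal_subst idJ Jw Jx.
Qed.

Lemma lifted_syzygies0_incl_mod :
  incl_mod (fun v => J ((v *m aug F) 0 0)) (fun v => I ((v *m aug F) 0 0)).
Proof.
move=> v /JI[w Iw]; have [_ [surj _ _] _] := F_res; have [x Ix] := surj w.
exists x; rewrite mulmxDl -scalemxAl mxE [X in _ + X]mxE.
exact: ideal_subst idI Iw Ix.
Qed.

(** The properties are carried through one induction: saturation and the two inclusions modulo [z]
    produce the lifted differential, whose kernel inherits them at the next level. *)
Lemma lifted_spec i :
  let N := @lifted_syzygies i in let M := @syzygies I i in
  let sh := @shift _ _ _ F i in
  [/\ saturated_submodule sh M, saturated_submodule sh N,
      incl_mod M N, incl_mod N M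
    & [/\ hom_mx sh (@shift _ _ _ F i.+1) (lift_diff N),
          exists E, lift_diff N = diff F i + z *: E & spans (lift_diff N) N]].
Proof.
have [[augF diffF] [surjF ex0 exS] minF] := F_res.
have spansM k : spans (diff F k) (@syzygies I k) by case: k.
have homF k : hom_mx (@shift _ _ _ F k) (@shift _ _ _ F k.+1) (diff F k).
  exact: diffF.
have lift k : let N := @lifted_syzygies k in let M := @syzygies I k in
    saturated_submodule (@shift _ _ _ F k) N -> incl_mod M N -> incl_mod N M ->
    [/\ hom_mx (@shift _ _ _ F k) (@shift _ _ _ F k.+1) (lift_diff N),
          exists E, lift_diff N = diff F k + z *: E & spans (lift_diff N) N].
  move=> N M gN MN NM; rewrite /lift_diff.
  exact: (epsilon_spec _ _ (lift_generators (homF k) gN (spansM k) MN NM)).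
elim: i => [|i [gM gN MN NM [homD [E DE] DN]]].
  have gI := saturated_syzygies0 idI grI satI; have gJ := saturated_syzygies0 idJ grJ satJ.
  have IJ0 := syzygies0_incl_mod; have JI0 := lifted_syzygies0_incl_mod.
  by split=> //; apply: lift.
have gM' := ker_saturated_submodule (homF i); have gN' := ker_saturated_submodule homD.
have [[_ _ satM] [_ _ satN]] := (gM, gN).
have MN' : incl_mod (@syzygies I i.+1) (@lifted_syzygies i.+1).
  by rewrite /= DE; apply: (ker_incl_mod satN); rewrite -DE.
have NM' : incl_mod (@lifted_syzygies i.+1) (@syzygies I i.+1).
  (* The roles are symmetric: the old differential is the new one plus a multiple of [z]. *)
  rewrite /=; have FD : diff F i = lift_diff (@lifted_syzygies i) + z *: - E.
    by rewrite DE scalerN addrK.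
  by rewrite FD; apply: (ker_incl_mod satM); rewrite -FD; apply: spansM.
by split=> //; apply: lift.
Qed.

Lemma lifted_resolution :
  minimal_graded_free_resolution a J lifted_complex.
Proof.
have [[augF diffF] _ minF] := F_res.
split.
- by split=> // i; have [_ _ _ _ [homD _ _]] := lifted_spec i; apply: homD.
- split=> [p|v|i v] /=; first exact: aug_surj.
    by have [_ _ _ _ [_ _]] := lifted_spec 0; apply.
  by have [_ _ _ _ [_ _]] := lifted_spec i.+1; apply.
(* Multiples of [z] have no constant term, so minimality survives. *)
move=> i k l /=; have [_ _ _ _ [_ [E ->] _]] := lifted_spec i.
by rewrite !mxE mcoeffD minF add0r rmorphM /= mcoeffX mnm1_eq0 mul0r.
Qed.

End Resolution.
End Lifting.

(** * The toric ideal: grading, saturation and binomials *)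

Section Binomials.
Variables (K : fieldType) (r m : nat) (a : 'I_m -> 'X_{1..r}).
Local Notation A := {mpoly K[m]}.
Local Notation toric := (@toric_ideal K r m a).

Definition toric_map : A -> {mpoly K[r]} :=
  mmap (@mpolyC r K) (fun i => 'X_[K, a i]).

Lemma mmap1_wdeg u : mmap1 (fun i => 'X_[K, a i]) u = 'X_[wdeg a u].
Proof.
rewrite /mmap1 /wdeg (big_morph _ (@mpolyXD r K) (mpolyX0 r K)).
by apply: eq_bigr => i _; rewrite mpolyXn.
Qed.

Lemma toric_mapE p :
  toric_map p = \sum_(u <- msupp p) p@_u *: 'X_[wdeg a u].
Proof. by apply: eq_bigr => u _; rewrite mmap1_wdeg mul_mpolyC. Qed.

Lemma toric_mapX u : toric_map 'X_[u] = 'X_[wdeg a u].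
Proof. by rewrite /toric_map mmapX mmap1_wdeg. Qed.

Lemma is_ideal_toric : is_ideal toric.
Proof.
split=> [|p q|c p]; rewrite /toric_ideal; first exact: rmorph0.
  by rewrite rmorphD /= => -> ->; rewrite addr0.
by rewrite rmorphM /= => ->; rewrite mulr0.
Qed.

Lemma toric_mfilter (P : pred 'X_{1..r}) p :
  toric_map (mfilter (fun u => P (wdeg a u)) p) = mfilter P (toric_map p).
Proof.
rewrite [in RHS]toric_mapE mfilter_sum /mfilter /toric_map rmorph_sum /=.
rewrite big_mkcond; apply: eq_bigr => u _.
rewrite -!/(mfilter _ _) mfilter_term; case: ifP => // _.
by rewrite mmapZ mmapX mmap1_wdeg mul_mpolyC.
Qed.

Lemma graded_toric : graded_ideal a toric.
Proof.
move=> P p; rewrite /toric_ideal -!/(toric_map _) toric_mfilter => ->.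
exact: mfilter0.
Qed.

(** The image of ['X_j] is a monomial, hence nonzero in a domain. *)
Lemma toric_sat j p : toric ('X_j * p) -> toric p.
Proof.
rewrite /toric_ideal rmorphM /= -!/(toric_map _) toric_mapX => /eqP.
by rewrite mulf_eq0 -msupp_eq0 msuppX => /eqP.
Qed.

Lemma toric_binomial u v : wdeg a u = wdeg a v -> toric ('X_[u] - 'X_[v]).
Proof.
move=> uv; rewrite /toric_ideal rmorphB /= -!/(toric_map _) !toric_mapX uv.
exact: subrr.
Qed.

(** If [u] were alone in its degree, its coefficient would survive in the image of [p]. *)
Lemma toric_other_monomial p u : toric p -> u \in msupp p ->
  exists v, [/\ v \in msupp p, v != u & wdeg a v = wdeg a u].
Proof.
rewrite /toric_ideal -/(toric_map p) toric_mapE => p0 up.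
have [/hasP[v vp /andP[vu /eqP vE]]|/hasPn nv] :=
  boolP (has (fun v => (v != u) && (wdeg a v == wdeg a u)) (msupp p)).
  by exists v.
move: (congr1 (mcoeff (wdeg a u)) p0); rewrite mcoeff0 linear_sum /=.
rewrite (bigD1_seq u) ?msupp_uniq //= mcoeffZ mcoeffX eqxx mulr1.
rewrite big_seq_cond big1 ?addr0 => [pu0|v /andP[/nv + vu]].
  by rewrite mcoeff_msupp pu0 eqxx in up.
by rewrite vu mcoeffZ mcoeffX /= => /negbTE ->; rewrite mulr0.
Qed.

End Binomials.

(** * Monomial ideals and leading monomials *)

Section MonomialIdeals.
Variables (K : fieldType) (m s : nat) (e : 'I_s -> 'X_{1..m}).
Local Notation A := {mpoly K[m]}.

Lemma monomial_idealP (p : A) :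
  ideal_gen (fun q => exists l, q = 'X_[e l]) p <->
  forall u, u \in msupp p -> exists l, (e l <= u)%MM.
Proof.
split=> [|sp].
  pose L (q : A) := forall u, u \in msupp q -> exists l, (e l <= u)%MM.
  apply: (ideal_gen_least (L := L)); last first.
    by move=> _ [l ->] u; rewrite msuppX inE => /eqP ->; exists l; apply: lepm_refl.
  split=> [u|q1 q2 L1 L2 u /msuppD_le|c q Lq u]; first by rewrite msupp0.
    by rewrite mem_cat => /orP[/L1|/L2].
  move=> /msuppM_le /allpairsP[[v w] /= [_ /Lq[l lw] ->]].
  by exists l; apply: lepm_trans lw _; apply: lem_addl.
have [I0 ID IM] := is_ideal_gen (fun q : A => exists l, q = 'X_[e l]).
rewrite [p]mpolyE big_seq; apply: big_ind => // u /sp[l lu].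
rewrite -(submK lu) mpolyXD -mul_mpolyC mulrA; apply: IM.
by apply: ideal_gen_mem; exists l.
Qed.

End MonomialIdeals.

Section LeadingMonomials.
Variables (K : fieldType) (m : nat) (le : rel 'X_{1..m}).
Hypothesis le_mo : monomial_order le.
Implicit Types (f : {mpoly K[m]}).

Lemma LM_spec f : f != 0 ->
  LM le f \in msupp f /\ forall u, u \in msupp f -> le u (LM le f).
Proof.
have [tot anti trans _ le0] := le_mo.
have refl u : le u u by have := tot u u; rewrite orbb.
rewrite -msupp_eq0 /LM; elim: (msupp f) => //= u s IH _; rewrite big_cons.
have [->|/IH[]] := eqVneq s [::].
  (* The default exponent 0 is the least monomial, so it can win against [u] only when equal to
     it. *)
  rewrite big_nil mem_seq1; have uE : (if le u 0%MM then 0%MM else u) = u.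
    by case: ifP => // u0; apply: anti; rewrite u0 le0.
  by rewrite uE; split=> // v; rewrite mem_seq1 => /eqP ->.
set b := (X in X \in _ -> _); move=> bs bmax; case: ifP => ub; split.
- by rewrite inE bs orbT.
- by move=> v; rewrite inE => /orP[/eqP ->|/bmax].
- by rewrite inE eqxx.
move=> v; rewrite inE => /orP[/eqP ->|/bmax vb] //.
by apply: trans vb _; have := tot u b; rewrite ub.
Qed.

End LeadingMonomials.

(** * The toric ideal and its initial ideal modulo [z_j] *)

Section ToricInitialIdeal.
Variables (K : fieldType) (r m : nat) (a : 'I_m -> 'X_{1..r}) (j : 'I_m).
Variables (le : rel 'X_{1..m}) (s : nat) (f : 'I_s -> {mpoly K[m]}).
Local Notation A := {mpoly K[m]}.
Local Notation I := (@toric_ideal K r m a).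
Local Notation J := (initial_ideal le I).
Hypothesis a_gt0 : forall i, (0 < mdeg (a i))%N.
Hypothesis le_mo : monomial_order le.
Hypothesis f_mgb : minimal_groebner_basis le I f.
Hypothesis f_homog : forall l, exists g, homog_of a g (f l).
Hypothesis f_supp : forall l, in_support j (f l) /\ ~~ (U_(j) <= LM le (f l))%MM.

Lemma initial_idealP (p : A) :
  J p <-> forall u, u \in msupp p -> exists l, (LM le (f l) <= u)%MM.
Proof.
have [_ JE _] := f_mgb.
by rewrite JE; apply: (monomial_idealP (fun l => LM le (f l))).
Qed.

Lemma is_ideal_initial : is_ideal J.
Proof. exact: is_ideal_gen. Qed.

Lemma graded_initial : graded_ideal a J.
Proof.
move=> P p /initial_idealP Jp; apply/initial_idealP => u.
rewrite mcoeff_msupp mcoeff_mfilter; case: ifP => [_|]; last by rewrite eqxx.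
by rewrite -mcoeff_msupp; apply: Jp.
Qed.

(** No generator [LM (f l)] involves [z_j], so one that divides [z_j] times a monomial divides the
    monomial. *)
Lemma initial_sat p : J ('X_j * p) -> J p.
Proof.
move=> /initial_idealP Jp; apply/initial_idealP => u up.
have [|l /mnm_lepP lu] := Jp (U_(j) + u)%MM.
  by rewrite mulrC (perm_mem (msuppMX _ _)) map_f.
exists l; apply/mnm_lepP => i; move: (lu i); rewrite mnmDE mnm1E.
have [<- _|//] := eqVneq j i.
by have [_] := f_supp l; rewrite lep1mP negbK => /eqP ->.
Qed.

Lemma LM_exchange l : exists w, [/\ wdeg a w = wdeg a (LM le (f l)),
  (U_(j) <= w)%MM, w != LM le (f l) & le w (LM le (f l))].
Proof.
have [fI _ _] := f_mgb; have [_ /eqP fl0] := fI l.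
have [LMl lmax] := LM_spec le_mo fl0.
have [[w [wl jw]] jLM] := f_supp l; have [g gP] := f_homog l.
exists w; split; [by rewrite !gP|by []| |exact: lmax].
by apply: contraNneq jLM => <-.
Qed.

Lemma initial_incl_mod : ideal_incl_mod j J I.
Proof.
have [I0 ID IM] := is_ideal_toric K a; have [_ JE _] := f_mgb.
move=> p /JE; apply: (ideal_gen_least (L := fun q : A => exists w, I (q + 'X_j * w))).
  split=> [|p1 p2 [w1 I1] [w2 I2]|c q [w Iw]].
  - by exists 0; rewrite mulr0 addr0.
  - by exists (w1 + w2); rewrite mulrDr addrACA; apply: ID.
  by exists (c * w); rewrite mulrCA -mulrDr; apply: IM.
move=> _ [l ->]; have [w [wE jw _ _]] := LM_exchange l.
exists (- 'X_[w - U_(j)]); rewrite mulrN -mpolyXD addmC submK //.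
exact: toric_binomial.
Qed.

(** The binomial with terms [u] and [v] lies in the toric ideal, so its leading monomial is not
    standard. *)
Lemma standard_unique u v :
    wdeg a u = wdeg a v -> u != v ->
  exists l, (LM le (f l) <= u)%MM || (LM le (f l) <= v)%MM.
Proof.
move=> uvE uv; pose b : A := 'X_[u] - 'X_[v].
have b0 : b != 0.
  apply: contra_neq uv => /(congr1 (mcoeff u)).
  rewrite mcoeffB !mcoeffX eqxx mcoeff0 [v == u]eq_sym.
  by case: eqP => // _ /eqP; rewrite subr0 oner_eq0.
have [LMb _] := LM_spec le_mo b0.
have /initial_idealP/(_ (LM le b))[|l lb] : J 'X_[LM le b].
- apply: ideal_gen_mem; exists b; split=> //; first exact: toric_binomial.
  exact/eqP.
- by rewrite msuppX mem_seq1.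
exists l; move: (msuppB_le LMb); rewrite mem_cat !msuppX !inE.
by case/orP => /eqP <-; rewrite lb ?orbT.
Qed.

(** As all [a i] are nonzero, only finitely many monomials share a degree. *)
Lemma mdeg_wdeg u : (mdeg u <= mdeg (wdeg a u))%N.
Proof.
rewrite /wdeg mdeg_sum mdegE; apply: leq_sum => i _.
by rewrite mdegMn leq_pmull.
Qed.

Lemma standard_multiple u : (U_(j) <= u)%MM ->
  exists v, [/\ wdeg a v = wdeg a u, (U_(j) <= v)%MM
    & forall l, ~~ (LM le (f l) <= v)%MM].
Proof.
move=> ju; have [tot anti trans leD _] := le_mo.
have refl v : le v v by have := tot v v; rewrite orbb.
(* The minimum is taken in the finite type of monomials of total degree below [b]. *)
pose b := (mdeg (wdeg a u)).+1.
have bd v : wdeg a v = wdeg a u -> (mdeg v < b)%N.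
  by move=> vE; rewrite /b -vE ltnS mdeg_wdeg.
pose P (k : 'X_{1..m < b}) := (wdeg a k == wdeg a u) && (U_(j) <= bmnm k)%MM.
have Pu : P (BMultinom (bd u erefl)) by rewrite /P /= eqxx.
have [k /andP[/eqP kE jk] kmin] :=
  extremumP (@bmnm m b) refl trans tot Pu.
exists (bmnm k); split=> // l; apply/negP => lk.
have [w [wE jw wl lew]] := LM_exchange l.
(* Exchanging [LM (f l)] for [w] keeps the degree and divisibility by [z_j] without going up in the
   order. Minimality then forces [v = k], hence [w = LM (f l)], a contradiction. *)
pose v := (w + (k - LM le (f l)))%MM.
have kE' : bmnm k = (LM le (f l) + (k - LM le (f l)))%MM by rewrite addmC submK.
have vE : wdeg a v = wdeg a u by rewrite wdegD wE -wdegD -kE'.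
have := kmin (BMultinom (bd v vE)); rewrite /P /= vE eqxx /=.
have jv : (U_(j) <= v)%MM by apply: lepm_trans jw _; apply: lem_addr.
move=> /(_ jv) kv; have vk : le v k by rewrite [X in le _ X]kE'; apply: leD.
have : v = bmnm k by apply: anti; rewrite vk.
by rewrite [RHS]kE' => /addIm /eqP; rewrite (negbTE wl).
Qed.

Lemma toric_incl_mod : ideal_incl_mod j I J.
Proof.
move=> p Ip.
pose q : A := \sum_(u <- msupp p | (U_(j) <= u)%MM) p@_u *: 'X_[u - U_(j)].
exists (- q); have -> : p + 'X_j * - q = mfilter (fun u => ~~ (U_(j) <= u)%MM) p.
  rewrite [X in X + _]mpolyE (bigID (fun u => (U_(j) <= u)%MM)) /= mulrN mulr_sumr.
  rewrite [X in X + _ - _](eq_bigr (fun u => 'X_j * (p@_u *: 'X_[u - U_(j)]))).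
    by rewrite addrC addKr.
  by move=> u ju; rewrite -scalerAr -mpolyXD addmC submK.
apply/initial_idealP => u; rewrite mcoeff_msupp mcoeff_mfilter.
case: ifP => [ju|]; last by rewrite eqxx.
rewrite -mcoeff_msupp => up.
have [v [_ vu vE]] := toric_other_monomial Ip up.
have [l /orP[lv|]] := standard_unique vE vu; last by exists l.
(* Here [v] is not standard. The exchange shows that its degree contains a multiple of [z_j], hence
   a standard one, [x]. It differs from [u], which [z_j] does not divide, so [u] is not standard. *)
have [w [wE jw _ _]] := LM_exchange l.
have [|x [xE jx xstd]] := @standard_multiple (w + (v - LM le (f l)))%MM.
  by apply: lepm_trans jw _; apply: lem_addr.
have xu : x != u by apply: contraNneq ju => <-.
have [|l' /orP[]] := @standard_unique x u _ xu; last by exists l'.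
  by rewrite xE wdegD wE -wdegD addmC submK.
by rewrite (negbTE (xstd l')).
Qed.

End ToricInitialIdeal.

(** * Comparison of Betti numbers *)

Lemma mingen_gt0 r m (Gamma : 'X_{1..r} -> Prop) (a : 'I_m -> 'X_{1..r}) i :
  minimally_generated Gamma a -> (0 < mdeg (a i))%N.
Proof.
move=> [GE /(_ i)]; rewrite lt0n mdeg_eq0; have [ai0 []|//] := eqVneq (a i) 0%MM.
move=> g; rewrite GE; split=> [[u [_ ->]]|[u [_ ->]]]; last by exists u.
exists [multinom if k == i then 0%N else u k | k < m]; split=> [k|].
  by rewrite negbK mnmE => ->.
apply: eq_bigr => k _; rewrite mnmE; case: eqP => // ->.
by rewrite ai0; apply/mnmP => l; rewrite !mulmnE !mnm0E !mul0n.
Qed.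

(** Lifting preserves ranks and works in both directions, so the predicates defining the two Betti
    numbers coincide and [epsilon] selects the same value. *)
Lemma betti_deformation (K : fieldType) (r m : nat) (a : 'I_m -> 'X_{1..r})
    (j : 'I_m) (I J : {mpoly K[m]} -> Prop) :
    (0 < mdeg (a j))%N -> is_ideal I -> is_ideal J ->
    graded_ideal a I -> graded_ideal a J ->
    (forall p, I ('X_j * p) -> I p) -> (forall p, J ('X_j * p) -> J p) ->
    ideal_incl_mod j I J -> ideal_incl_mod j J I ->
  forall i, betti a I i = betti a J i.
Proof.
move=> aj idI idJ grI grJ satI satJ IJ JI i; rewrite /betti; congr epsilon.
apply: functional_extensionality => b; apply: propositional_extensionality.
split=> -[F [Fres <-]].
  by exists (lifted_complex a j J F); split=> //; apply: lifted_resolution Fres.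
by exists (lifted_complex a j I F); split=> //; apply: lifted_resolution Fres.
Qed.

Theorem theorem3p1 (K : fieldType) (r n : nat)
    (Gamma : 'X_{1..r} -> Prop) (a : 'I_(r + n) -> 'X_{1..r})
    (Gamma_affine : affine_semigroup Gamma)
    (Gamma_simplicial : simplicial Gamma (fun i : 'I_r => a (lshift n i)))
    (Gamma_mingen : minimally_generated Gamma a)
    (CM_toric : quotient_CM (@toric_ideal K r (r + n) a))
    (le : rel 'X_{1..(r + n)}) (le_mo : monomial_order le)
    (s : nat) (f : 'I_s -> {mpoly K[r + n]})
    (f_mgb : minimal_groebner_basis le (@toric_ideal K r (r + n) a) f)
    (f_homog : forall l, exists g, homog_of a g (f l))
    (CM_initial : quotient_CM (initial_ideal le (@toric_ideal K r (r + n) a)))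
    (z_supp : exists j : 'I_r, forall l : 'I_s,
       in_support (lshift n j) (f l) /\
       ~~ (U_(lshift n j) <= LM le (f l))%MM) :
  forall i : nat, (1 <= i)%N ->
    betti a (@toric_ideal K r (r + n) a) i =
    betti a (initial_ideal le (@toric_ideal K r (r + n) a)) i.
Proof.
move=> i _; have [j jP] := z_supp; have a_gt0 k := mingen_gt0 k Gamma_mingen.
apply: (betti_deformation (j := lshift n j)) => //.
- exact: is_ideal_toric.
- exact: is_ideal_initial.
- exact: graded_toric.
- exact: graded_initial f_mgb.
- exact: toric_sat.
- exact: initial_sat f_mgb jP.
- exact: toric_incl_mod a_gt0 le_mo f_mgb f_homog jP.
exact: initial_incl_mod le_mo f_mgb f_homog jP.
Qed.
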